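(* Let $a,b,c$ be integers and let $n$ be an integer with $n\geq 1$. Then $$\begin{aligned} \mathcal{QK}_{n+1}^{(a,b,c)}\cdot \mathcal{QK}_{n-1}^{(a,b,c)}-\left(\mathcal{QK}_{n}^{(a,b,c)}\right)^{2}={}&\mathcal{QM}_{n+1}^{(a,b,c)}\cdot \mathcal{QM}_{n-1}^{(a,b,c)}-\left(\mathcal{QM}_{n}^{(a,b,c)}\right)^{2}\\ &+2^{n}\Theta\left(2\mathcal{QM}_{n+2}^{(a,b,c)}-\mathcal{QM}_{n}^{(a,b,c)}\right)\\ &+2^{n-1}\left(\mathcal{QM}_{n+1}^{(a,b,c)}-2\mathcal{QM}_{n}^{(a,b,c)}\right)\Theta, \end{aligned}$$ where $\Theta=1+2^{a}\mathbf{i}+2^{b}\mathbf{j}+2^{c}\mathbf{k}$ and $\mathcal{QM}_{m}^{(a,b,c)}=M_{m}+M_{m+a}\mathbf{i}+M_{m+b}\mathbf{j}+M_{m+c}\mathbf{k}$.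
   Context: For an integer $m$, let $M_m=2$ if $m\equiv 0 \pmod 3$ and $M_m=-1$ if $m\equiv 1,2\pmod 3$. The modified third-order Jacobsthal numbers are $K_m^{(3)}=2^m+M_m$; this formula is used for all integers $m$ (rational values for negative $m$). Quaternions have basis $1,\mathbf{i},\mathbf{j},\mathbf{k}$ with the (noncommutative) multiplication $\mathbf{i}^2=\mathbf{j}^2=\mathbf{k}^2=-1$, $\mathbf{i}\mathbf{j}=-\mathbf{j}\mathbf{i}=\mathbf{k}$, $\mathbf{j}\mathbf{k}=-\mathbf{k}\mathbf{j}=\mathbf{i}$, $\mathbf{k}\mathbf{i}=-\mathbf{i}\mathbf{k}=\mathbf{j}$. The unrestricted modified third-order Jacobsthal quaternion is $\mathcal{QK}_{n}^{(a,b,c)}=K_{n}^{(3)}+K_{n+a}^{(3)}\mathbf{i}+K_{n+b}^{(3)}\mathbf{j}+K_{n+c}^{(3)}\mathbf{k}$, where $a,b,c$ are fixed integers. *)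

(* Defs.v *)
From HB Require Import structures.
From mathcomp Require Import all_boot all_order all_algebra.
From mathcomp Require Import ring.

Set Implicit Arguments.
Unset Strict Implicit.
Unset Printing Implicit Defensive.

Import Order.TTheory GRing.Theory Num.Theory.
Local Open Scope ring_scope.

(* [Quat x y z t] stands for x + y i + z j + t k. *)
Record quat (R : Type) : Type := Quat { qre : R; qim_i : R; qim_j : R; qim_k : R }.

Definition quat_to_tuple (R : Type) (p : quat R) : R * R * R * R :=
  (qre p, qim_i p, qim_j p, qim_k p).
Definition quat_of_tuple (R : Type) (u : R * R * R * R) : quat R :=
  let: (x, y, z, t) := u in Quat x y z t.
Lemma quat_to_tupleK (R : Type) :
  cancel (@quat_to_tuple R) (@quat_of_tuple R).
Proof. by case. Qed.

HB.instance Definition _ (R : eqType) :=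
  Equality.copy (quat R) (can_type (@quat_to_tupleK R)).
HB.instance Definition _ (R : choiceType) :=
  Choice.copy (quat R) (can_type (@quat_to_tupleK R)).

Section QuatAlgebra.
Variable R : comNzRingType.
Implicit Types (a b : R) (p q r : quat R).

Definition addq p q : quat R :=
  Quat (qre p + qre q) (qim_i p + qim_i q)
       (qim_j p + qim_j q) (qim_k p + qim_k q).
Definition oppq p : quat R :=
  Quat (- qre p) (- qim_i p) (- qim_j p) (- qim_k p).
Definition zeroq : quat R := Quat 0 0 0 0.
Definition oneq : quat R := Quat 1 0 0 0.
(* Bilinear extension of the multiplication table of 1, i, j, k; the table
   itself is recovered in [qiqi], ..., [qiqk] below. *)
Definition mulq p q : quat R :=
  let: Quat p0 p1 p2 p3 := p in
  let: Quat q0 q1 q2 q3 := q in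
  Quat (p0 * q0 - p1 * q1 - p2 * q2 - p3 * q3)
       (p0 * q1 + p1 * q0 + p2 * q3 - p3 * q2)
       (p0 * q2 - p1 * q3 + p2 * q0 + p3 * q1)
       (p0 * q3 + p1 * q2 - p2 * q1 + p3 * q0).
Definition scaleq a p : quat R :=
  Quat (a * qre p) (a * qim_i p) (a * qim_j p) (a * qim_k p).

Fact addqA : associative addq.
Proof. by move=> [? ? ? ?] [? ? ? ?] [? ? ? ?]; rewrite /addq /= !addrA. Qed.
Fact addqC : commutative addq.
Proof. by move=> p q; rewrite /addq; congr Quat; rewrite addrC. Qed.
Fact add0q : left_id zeroq addq.
Proof. by move=> [? ? ? ?]; rewrite /addq /= !add0r. Qed.
Fact addNq : left_inverse zeroq oppq addq.
Proof. by move=> [? ? ? ?]; rewrite /addq /= !addNr. Qed.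

HB.instance Definition _ :=
  GRing.isZmodule.Build (quat R) addqA addqC add0q addNq.

Fact mulqA : associative mulq.
Proof. by move=> [? ? ? ?] [? ? ? ?] [? ? ? ?]; congr Quat; ring. Qed.
Fact mul1q : left_id oneq mulq.
Proof. by move=> [? ? ? ?]; congr Quat; ring. Qed.
Fact mulq1 : right_id oneq mulq.
Proof. by move=> [? ? ? ?]; congr Quat; ring. Qed.
Fact mulqDl : left_distributive mulq addq.
Proof. by move=> [? ? ? ?] [? ? ? ?] [? ? ? ?]; congr Quat => /=; ring. Qed.
Fact mulqDr : right_distributive mulq addq.
Proof. by move=> [? ? ? ?] [? ? ? ?] [? ? ? ?]; congr Quat => /=; ring. Qed.
Fact oneq_neq0 : oneq != zeroq.
Proof. by apply/eqP=> -[/eqP]; rewrite oner_eq0. Qed.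

HB.instance Definition _ :=
  GRing.Zmodule_isNzRing.Build (quat R) mulqA mul1q mulq1 mulqDl mulqDr
    oneq_neq0.

Fact scaleqA a b p : scaleq a (scaleq b p) = scaleq (a * b) p.
Proof. by rewrite /scaleq /= !mulrA. Qed.
Fact scale1q : left_id 1 scaleq.
Proof. by move=> [? ? ? ?]; rewrite /scaleq /= !mul1r. Qed.
Fact scaleqDr : right_distributive scaleq addq.
Proof. by move=> a p q; rewrite /scaleq /addq /= !mulrDr. Qed.
Fact scaleqDl p : {morph scaleq^~ p : a b / a + b >-> addq a b}.
Proof. by move=> a b; rewrite /scaleq /addq /= !mulrDl. Qed.

HB.instance Definition _ :=
  GRing.Zmodule_isLmodule.Build R (quat R) scaleqA scale1q scaleqDr scaleqDl.

Fact scaleqAl a p q : a *: (p * q) = (a *: p) * q.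
Proof. by case: p q => [? ? ? ?] [? ? ? ?]; congr Quat => /=; ring. Qed.

HB.instance Definition _ :=
  GRing.Lmodule_isLalgebra.Build R (quat R) scaleqAl.

Fact scaleqAr a p q : a *: (p * q) = p * (a *: q).
Proof. by case: p q => [? ? ? ?] [? ? ? ?]; congr Quat => /=; ring. Qed.

HB.instance Definition _ :=
  GRing.Lalgebra_isAlgebra.Build R (quat R) scaleqAr.

Definition qi : quat R := Quat 0 1 0 0.
Definition qj : quat R := Quat 0 0 1 0.
Definition qk : quat R := Quat 0 0 0 1.

Lemma qiqi : qi * qi = -1. Proof. by congr Quat => /=; ring. Qed.
Lemma qjqj : qj * qj = -1. Proof. by congr Quat => /=; ring. Qed.
Lemma qkqk : qk * qk = -1. Proof. by congr Quat => /=; ring. Qed.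
Lemma qiqj : qi * qj = qk. Proof. by congr Quat => /=; ring. Qed.
Lemma qjqi : qj * qi = - qk. Proof. by congr Quat => /=; ring. Qed.
Lemma qjqk : qj * qk = qi. Proof. by congr Quat => /=; ring. Qed.
Lemma qkqj : qk * qj = - qi. Proof. by congr Quat => /=; ring. Qed.
Lemma qkqi : qk * qi = qj. Proof. by congr Quat => /=; ring. Qed.
Lemma qiqk : qi * qk = - qj. Proof. by congr Quat => /=; ring. Qed.

Lemma quatE (x y z t : R) :
  x%:A + y *: qi + z *: qj + t *: qk = Quat x y z t.
Proof. by congr Quat => /=; ring. Qed.

End QuatAlgebra.

Arguments qi {R}.
Arguments qj {R}.
Arguments qk {R}.

Section Jacobsthal.
Variable R : realFieldType.
Implicit Types a b c m : int.

Definition Mseq m : R := if (3 %| m)%Z then 2 else -1.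

(* The exponent is an integer, so this is 2 ^- n + Mseq m when m = - n. *)
Definition Kseq m : R := 2 ^ m + Mseq m.

Definition QK a b c m : quat R :=
  (Kseq m)%:A + Kseq (m + a) *: qi + Kseq (m + b) *: qj + Kseq (m + c) *: qk.

Definition QM a b c m : quat R :=
  (Mseq m)%:A + Mseq (m + a) *: qi + Mseq (m + b) *: qj + Mseq (m + c) *: qk.

Definition Theta a b c : quat R :=
  1 + 2 ^ a *: qi + 2 ^ b *: qj + 2 ^ c *: qk.

End Jacobsthal.

(* Main.v *)
Require Import Defs.
From mathcomp Require Import all_boot all_order all_algebra.
From mathcomp Require Import ring.

Import Order.TTheory GRing.Theory Num.Theory.
Local Open Scope ring_scope.

(** Since QK_m = 2^m Theta + QM_m, expanding the left-hand side cancels the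
    Theta^2 terms, as 2^(n+1) 2^(n-1) = (2^n)^2; what remains is the
    right-hand side because QM has period 3, so that QM_(n-1) = QM_(n+2). *)

Lemma Mseq_periodic (R : realFieldType) (m : int) : Mseq R (m + 3) = Mseq R m.
Proof. by rewrite /Mseq rpredDr. Qed.

Lemma QM_periodic (R : realFieldType) (a b c m : int) :
  QM R a b c (m + 3) = QM R a b c m.
Proof. by rewrite /QM !(addrAC m 3) !Mseq_periodic. Qed.

(** As 2 is nonzero in [R], [2 ^ (m + d)] splits for negative exponents too, so [2 ^ m] factors out
    of each coordinate. *)
Lemma QK_decomp (R : realFieldType) (a b c m : int) :
  QK R a b c m = (2 ^ m : R) *: Theta R a b c + QM R a b c m.
Proof.
have pow2D (d : int) : (2 : R) ^ (m + d) = 2 ^ m * 2 ^ d.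
  by rewrite expfzDr ?pnatr_eq0.
by rewrite /QK /QM /Theta /Kseq !pow2D !quatE; congr Quat => /=; ring.
Qed.

(** Here [s] is [2 ^ (n - 1)], [T] is [Theta], and [P], [Q], [N] are [QM] at [n + 1], [n], [n - 1].
    Quaternions do not commute, so [T] stays left in one cross term and right in the other. *)
Lemma quat_cassini_expand (R : comNzRingType) (s : R) (T P Q N : quat R) :
  ((2 * (2 * s)) *: T + P) * (s *: T + N) - ((2 * s) *: T + Q) ^+ 2
  = P * N - Q ^+ 2 + (2 * s) *: (T * ((2 : R) *: N - Q))
    + s *: ((P - (2 : R) *: Q) * T).
Proof.
rewrite !expr2; case: T P Q N => [? ? ? ?] [? ? ? ?] [? ? ? ?] [? ? ? ?].
by congr Quat => /=; ring.
Qed.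

Theorem theorem2p8 (R : realFieldType) (a b c n : int) (hn : 1 <= n) :
  QK R a b c (n + 1) * QK R a b c (n - 1) - QK R a b c n ^+ 2
  = QM R a b c (n + 1) * QM R a b c (n - 1) - QM R a b c n ^+ 2
    + (2 ^ n : R) *: (Theta R a b c
        * ((2 : R) *: QM R a b c (n + 2) - QM R a b c n))
    + (2 ^ (n - 1) : R) *: ((QM R a b c (n + 1) - (2 : R) *: QM R a b c n)
        * Theta R a b c).
Proof.
have pow2S (m : int) : (2 : R) ^ (m + 1) = 2 * 2 ^ m.
  by rewrite expfzDr ?pnatr_eq0 // expr1z mulrC.
have pow2n : (2 : R) ^ n = 2 * 2 ^ (n - 1) by rewrite -pow2S subrK.
(* Exposes a period, so that [QM] at [n + 2] becomes [N]. *)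
have -> : n + 2 = n - 1 + 3 by ring.
by rewrite QM_periodic !QK_decomp pow2S pow2n quat_cassini_expand.
Qed.
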